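(* Let $S$ be a finite nonempty set, let $1\le k<n$ be integers, and let $\phi:\mathbb{R}^{S^k}\times\prod_{\ell=k+1}^n\mathbb{R}^{S^{k+1}}\to\mathbb{R}^{S^n}$ be the parametrization map of the nonhomogeneous $k$-th order multistate Markov model on $S$ for paths of length $n$. Then the set $$\phi\Bigl(\mathbb{R}^{S^k}\times\prod_{\ell=k+1}^n\mathbb{R}^{S^{k+1}}\Bigr)\cap\Delta_{|S|^n-1}$$ is a decomposable hierarchical model (for $n$ discrete random variables, each with state space $S$).
   Context: **Parametrization.** Points of $\mathbb{R}^{S^k}\times\prod_{\ell=k+1}^n\mathbb{R}^{S^{k+1}}$ are written $(\pi,a)$ with coordinates $\pi_{i_1\ldots i_k}$ ($(i_1,\dots,i_k)\in S^k$) and $a^{(\ell)}_{i_{\ell-k}\cdots i_\ell}$ ($\ell=k+1,\dots,n$, $(i_{\ell-k},\dots,i_\ell)\in S^{k+1}$); all coordinates are arbitrary real numbers. The map $\phi$ is given by $$\phi_{i_1\ldots i_n}(\pi,a)=\pi_{i_1\ldots i_k}\prod_{\ell=k+1}^n a^{(\ell)}_{i_{\ell-k}\cdots i_{\ell-1}i_\ell},\qquad (i_1,\dots,i_n)\in S^n.$$ $\Delta_{|S|^n-1}\subset\mathbb{R}^{S^n}$ is the probability simplex of vectors with nonnegative entries summing to $1$. **Simplicial complexes.** A simplicial complex on $[m]=\{1,\dots,m\}$ is a collection $\Gamma\subseteq 2^{[m]}$ such that every subset of an element of $\Gamma$ also belongs to $\Gamma$; a facet is an inclusion-maximal element. $\Gamma$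 is reducible with decomposition $(\Gamma_1,B,\Gamma_2)$ if $\Gamma_1\cup\Gamma_2=\Gamma$, $\Gamma_1\cap\Gamma_2=2^B$, and $\Gamma_1,\Gamma_2\ne 2^B$. $\Gamma$ is decomposable if it is reducible and both components $\Gamma_1$ and $\Gamma_2$ are either decomposable or simplices (of the form $2^F$ for some $F$). **Hierarchical model.** Let $X_1,\dots,X_m$ be discrete random variables with finite state spaces $R_1,\dots,R_m$, let $R=\prod_{i=1}^m R_i$ be the joint state space, and let $\Gamma$ be a simplicial complex on $[m]$. The hierarchical model associated with $\Gamma$ consists of all probability distributions $(p_i)_{i\in R}$ on $R$ that admit a parametrization of the form $$p_i=\frac{1}{Z(\theta)}\prod_{F\text{ facet of }\Gamma}\theta^{(F)}_{i_F},\qquad i\in R,$$ where the $\theta^{(F)}_{i_F}$ are nonnegative parameters associated with the facet $F$, $i_F$ is the restriction of $i$ to the coordinates indexed by $F$, and $Z(\theta)$ is a normalizing constant ensuring $\sum_{i\in R}p_i=1$. The hierarchical model is called decomposable if $\Gamma$ is decomposable.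
   Formalization: For n = k+1 the model is the full probability simplex, whose complex is a simplex and so not decomposable under the literal definition (if |S| ≥ 2); there the formal statement also allows the complex to be a simplex. For n > k+1 literal decomposability is asserted. *)

(* Defs.v *)
From HB Require Import structures.
From mathcomp Require Import all_boot all_order all_algebra.
From mathcomp Require Import classical_sets reals.

Set Implicit Arguments.
Unset Strict Implicit.
Unset Printing Implicit Defensive.

Import Order.TTheory GRing.Theory Num.Theory.
Local Open Scope ring_scope.

(* The vertex set [m] = {1, ..., m} is 'I_m, i.e. everything is 0-based. *)

Definition simplicial_complex m (Gamma : {set {set 'I_m}}) : Prop :=
  forall F G : {set 'I_m}, F \in Gamma -> G \subset F -> G \in Gamma.

Definition facets m (Gamma : {set {set 'I_m}}) : {set {set 'I_m}} :=
  [set F | maxset (mem Gamma) F].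

Definition is_simplex m (Gamma : {set {set 'I_m}}) : Prop :=
  exists F : {set 'I_m}, Gamma = powerset F.

Definition reducible_with m (Gamma Gamma1 : {set {set 'I_m}}) (B : {set 'I_m})
    (Gamma2 : {set {set 'I_m}}) : Prop :=
  [/\ simplicial_complex Gamma1 /\ simplicial_complex Gamma2,
      Gamma1 :|: Gamma2 = Gamma,
      Gamma1 :&: Gamma2 = powerset B,
      Gamma1 <> powerset B &
      Gamma2 <> powerset B].

(* A simplex is never reducible, hence not [decomposable] in this sense. *)
Inductive decomposable m (Gamma : {set {set 'I_m}}) : Prop :=
| Decomposable (Gamma1 : {set {set 'I_m}}) (B : {set 'I_m})
    (Gamma2 : {set {set 'I_m}}) of
    reducible_with Gamma Gamma1 B Gamma2 &
    decomposable Gamma1 \/ is_simplex Gamma1 &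
    decomposable Gamma2 \/ is_simplex Gamma2.

Definition joint m (X : 'I_m -> finType) : finType :=
  {dffun forall j : 'I_m, X j}.

Definition marginal m (X : 'I_m -> finType) (F : {set 'I_m}) : finType :=
  {dffun forall j : {j : 'I_m | j \in F}, X (val j)}.

Definition restrict m (X : 'I_m -> finType) (F : {set 'I_m}) (i : joint X) :
    marginal X F :=
  [ffun j : {j : 'I_m | j \in F} => i (val j)].

Definition prob_simplex (R : realType) (T : finType) : set {ffun T -> R} :=
  [set p : {ffun T -> R} | (forall i, 0 <= p i) /\ \sum_i p i = 1]%classic.
Arguments prob_simplex R T : clear implicits.

Definition facet_prod (R : realType) m (X : 'I_m -> finType)
    (Gamma : {set {set 'I_m}})
    (theta : forall F : {set 'I_m}, {ffun marginal X F -> R})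
    (i : joint X) : R :=
  \prod_(F in facets Gamma) theta F (restrict F i).

(* If Z(theta) = 0 then the right-hand side is 0 for every i, which the
   membership in the probability simplex excludes. *)
Definition hierarchical_model (R : realType) m (X : 'I_m -> finType)
    (Gamma : {set {set 'I_m}}) : set {ffun joint X -> R} :=
  [set p : {ffun joint X -> R} | prob_simplex R (joint X) p /\
    exists theta : forall F : {set 'I_m}, {ffun marginal X F -> R},
      (forall F, F \in facets Gamma -> forall x, 0 <= theta F x) /\
      let Z := \sum_j facet_prod Gamma theta j in
      forall i, p i = Z^-1 * facet_prod Gamma theta i]%classic.
Arguments hierarchical_model R {m} X Gamma.

Definition path_space (S : finType) (n : nat) : finType :=
  joint (fun _ : 'I_n => S).

Lemma window_subproof n k (t : 'I_(n - k)) (j : 'I_k.+1) : (t + j < n)%N.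
Proof.
have := ltn_ord t; rewrite ltn_subRL addnC => tk.
by apply: leq_ltn_trans tk; rewrite leq_add2l -ltnS.
Qed.

Definition initial (S : finType) k n (hkn : (k < n)%N) (i : path_space S n) :
    path_space S k :=
  [ffun j : 'I_k => i (widen_ord (ltnW hkn) j)].

(* The 1-based time l = k+1, ..., n is encoded as t = l - k - 1 : 'I_(n - k),
   so that (i_{l-k}, ..., i_l) sits at the 0-based positions t, ..., t + k. *)
Definition window (S : finType) k n (i : path_space S n) (t : 'I_(n - k)) :
    path_space S k.+1 :=
  [ffun j : 'I_k.+1 => i (Ordinal (window_subproof t j))].

Definition markov_params (R : realType) (S : finType) (k n : nat) : Type :=
  ({ffun path_space S k -> R} *
   {ffun 'I_(n - k) -> {ffun path_space S k.+1 -> R}})%type.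

Definition markov_map (R : realType) (S : finType) k n (hkn : (k < n)%N)
    (x : markov_params R S k n) : {ffun path_space S n -> R} :=
  [ffun i => x.1 (initial hkn i) * \prod_(t < n - k) x.2 t (window i t)].
Arguments markov_map R S {k n} hkn x.

(* Main.v *)
(* The underlying complex is generated by the n - k windows {t, ..., t + k} of
   consecutive times.  A window meets the union of the earlier ones in a single
   proper face of the preceding window, whence decomposability.  The windows are
   the facets, so the Markov and the hierarchical parametrizations have the same
   shape once pi is absorbed into the factor of the first window.  Markov
   parameters may be negative, but a nonnegative image point is unchanged when
   every parameter is replaced by its absolute value. *)
Require Import Defs.
From HB Require Import structures.
From mathcomp Require Import all_boot all_order all_algebra.
From mathcomp Require Import zify.
From mathcomp Require Import classical_sets reals.

Set Implicit Arguments.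
Unset Strict Implicit.
Unset Printing Implicit Defensive.

Import Order.TTheory GRing.Theory Num.Theory.
Local Open Scope ring_scope.

Definition time_interval (n t l : nat) : {set 'I_n} :=
  [set j : 'I_n | (t <= j < t + l)%N].

(** It suffices to test the endpoints [t] and [t + l - 1], which the two hypotheses place in ['I_n];
    the larger interval may overrun [n]. *)
Lemma time_interval_subset (n t l s q : nat) : (0 < l)%N -> (t + l <= n)%N ->
  (time_interval n t l \subset time_interval n s q) =
    (s <= t)%N && (t + l <= s + q)%N.
Proof.
move=> l0 tln; apply/idP/andP => [/fintype.subsetP sub|[st tl]]; last first.
  by apply/fintype.subsetP => j; rewrite !inE; lia.
have ht : (t < n)%N by lia.
have hl : ((t + l).-1 < n)%N by lia.
by have := sub (Ordinal ht); have := sub (Ordinal hl); rewrite !inE /=; lia.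
Qed.

(** The number [r] of windows is kept free, so that the complex can grow by one window at a time. *)
Definition window_complex (n k r : nat) : {set {set 'I_n}} :=
  [set F : {set 'I_n} | [exists t : 'I_r, F \subset time_interval n t k.+1]].

Lemma simplicial_window_complex n k r :
  simplicial_complex (window_complex n k r).
Proof.
move=> F G; rewrite !inE => /existsP[t Ft] GF.
by apply/existsP; exists t; apply: fintype.subset_trans Ft.
Qed.

Lemma window_complex1 n k :
  window_complex n k 1 = powerset (time_interval n 0 k.+1).
Proof.
apply/setP => F; rewrite !inE; apply/existsP/idP => [[t]|Ft].
  by rewrite ord1.
by exists ord0.
Qed.

Lemma window_complexS n k r :
  window_complex n k r.+1 =
    window_complex n k r :|: powerset (time_interval n r k.+1).
Proof.
apply/setP => F; rewrite !inE; apply/existsP/orP => [[t Ft]|[/existsP[t Ft]|Ft]].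
- have [tr|tr] := ltnP t r; first by left; apply/existsP; exists (Ordinal tr).
  by right; have -> : r = t by have := ltn_ord t; lia.
- by exists (widen_ord (leqnSn r) t).
- by exists ord_max.
Qed.

(** Window [r.+1] starts at [r.+1] and the earlier windows stop at [r + k] at the latest; the [k]
    times in between all lie in window [r]. *)
Lemma window_complex_separator n k r :
  window_complex n k r.+1 :&: powerset (time_interval n r.+1 k.+1) =
    powerset (time_interval n r.+1 k).
Proof.
apply/setP => F; rewrite !inE; apply/andP/idP => [[/existsP[t Ft] Fr]|Fr].
  apply/fintype.subsetP => j jF; have := fintype.subsetP Ft _ jF; have := fintype.subsetP Fr _ jF.
  by rewrite !inE; have := ltn_ord t; lia.
split; last by apply: (fintype.subset_trans Fr); apply/fintype.subsetP => j; rewrite !inE; lia.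
apply/existsP; exists ord_max; apply: (fintype.subset_trans Fr).
by apply/fintype.subsetP => j; rewrite !inE /=; lia.
Qed.

Lemma window_complex_reducible n k r : (r.+1 + k < n)%N ->
  reducible_with (window_complex n k r.+2) (window_complex n k r.+1)
    (time_interval n r.+1 k) (powerset (time_interval n r.+1 k.+1)).
Proof.
move=> rkn; split.
- split; first exact: simplicial_window_complex.
  by move=> F G; rewrite !powersetE => Fr GF; apply: fintype.subset_trans Fr.
- by rewrite [RHS]window_complexS.
- exact: window_complex_separator.
(* Window [r] is a face of the first component, but its time [r] precedes the separator. *)
- move=> /setP /(_ (time_interval n r k.+1)); rewrite powersetE.
  rewrite time_interval_subset ?inE; [|lia..].
  rewrite (_ : (_ && _) = false); last by lia.
  by move=> /existsP; apply; exists ord_max.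
(* The last time of window [r.+1] lies beyond the separator. *)
- move=> /setP /(_ (time_interval n r.+1 k.+1)); rewrite !powersetE subxx.
  by rewrite time_interval_subset; lia.
Qed.

Lemma window_complex_decomposable n k r : (r + k < n)%N ->
  decomposable (window_complex n k r.+1) \/ is_simplex (window_complex n k r.+1).
Proof.
elim: r => [|r IHr] rkn.
  by right; exists (time_interval n 0 k.+1); rewrite window_complex1.
left; apply: (Decomposable (window_complex_reducible rkn)); first by apply: IHr; lia.
by right; exists (time_interval n r.+1 k.+1).
Qed.

Lemma time_interval_inj n k :
  injective (fun t : 'I_(n - k) => time_interval n t k.+1).
Proof.
move=> s t st; apply/val_inj => /=.
have hs := ltn_ord s; have ht := ltn_ord t.
have: time_interval n s k.+1 \subset time_interval n t k.+1 by rewrite st.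
by rewrite time_interval_subset; lia.
Qed.

(** All [n - k] windows fit into ['I_n] and have the same length, so none contains another. *)
Lemma facets_window_complex n k :
  facets (window_complex n k (n - k)) =
    [set time_interval n t k.+1 | t : 'I_(n - k)].
Proof.
apply/setP => F; rewrite inE; apply/maxsetP/imsetP => [[]|[t _ ->]].
  rewrite /= inE => /existsP[t Ft] Fmax; exists t => //; apply/esym/Fmax => //.
  by rewrite /= inE; apply/existsP; exists t.
have ht := ltn_ord t.
split=> [|B]; first by rewrite /= inE; apply/existsP; exists t.
rewrite /= inE => /existsP[s Bs] tB; have hs := ltn_ord s.
have ts := fintype.subset_trans tB Bs; apply/eqP; rewrite finset.eqEsubset tB andbT.
suff -> : t = s by [].
by apply/val_inj => /=; move: ts; rewrite time_interval_subset; lia.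
Qed.

Lemma facet_prod_window_complex (R : realType) (S : finType) n k
    (theta : forall F : {set 'I_n}, {ffun marginal (fun _ => S) F -> R})
    (i : path_space S n) :
  facet_prod (window_complex n k (n - k)) theta i =
    \prod_(t < n - k) theta (time_interval n t k.+1)
                            (restrict (time_interval n t k.+1) i).
Proof.
rewrite /facet_prod facets_window_complex big_imset //=.
by move=> s t _ _; apply: time_interval_inj.
Qed.

Lemma eq_restrict (S : finType) n (F : {set 'I_n}) (i j : path_space S n) :
  {in F, i =1 j} ->
  restrict F i = restrict F j :> marginal (fun _ : 'I_n => S) F.
Proof. by move=> ij; apply/ffunP => u; rewrite !ffunE ij ?(valP u). Qed.

Lemma eq_window (S : finType) n k (t : 'I_(n - k)) (i j : path_space S n) :
  {in time_interval n t k.+1, i =1 j} -> window i t = window j t.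
Proof.
move=> ij; apply/ffunP => u; rewrite !ffunE ij // inE /=.
by have := ltn_ord u; lia.
Qed.

Lemma eq_initial (S : finType) n k (hkn : (k < n)%N) (i j : path_space S n) :
  {in time_interval n 0 k.+1, i =1 j} -> initial hkn i = initial hkn j.
Proof.
move=> ij; apply/ffunP => u; rewrite !ffunE ij // inE /=.
by have := ltn_ord u; lia.
Qed.

Definition extend_marginal (S : finType) (s0 : S) n (F : {set 'I_n})
    (x : marginal (fun _ : 'I_n => S) F) : path_space S n :=
  [ffun j => if insub j is Some u then x u else s0].

Lemma extend_restrict (S : finType) (s0 : S) n (F : {set 'I_n})
    (i : path_space S n) :
  {in F, extend_marginal s0 (restrict F i) =1 i}.
Proof. by move=> j jF; rewrite ffunE insubT ffunE. Qed.

(** Outside the window, truncated subtraction and the default of [inord] yield arbitrary entries of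
    [y], which are never read. *)
Definition extend_window (S : finType) n k (t : nat) (y : path_space S k.+1) :
    path_space S n :=
  [ffun j : 'I_n => y (inord (j - t))].

Lemma extend_window_window (S : finType) n k (t : 'I_(n - k))
    (i : path_space S n) :
  {in time_interval n t k.+1, extend_window n t (window i t) =1 i}.
Proof.
move=> j; rewrite inE => /andP[tj jt]; rewrite !ffunE; congr (i _).
by apply/val_inj; rewrite /= inordK; lia.
Qed.

Lemma markov_map_hierarchical (R : realType) (S : finType) (s0 : S) n k
    (hkn : (k < n)%N) (x : markov_params R S k n) :
  prob_simplex R (path_space S n) (markov_map R S hkn x) ->
  hierarchical_model R (fun _ : 'I_n => S) (window_complex n k (n - k))
    (markov_map R S hkn x).
Proof.
move=> px; split=> //; have [p0 p1] := px.
(* The initial factor is absorbed into window 0, which contains the first [k] times. *)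
pose c t (i : path_space S n) : R :=
  (if val t == 0%N then `|x.1 (initial hkn i)| else 1) * `|x.2 t (window i t)|.
(* Parameters are indexed by sets, so [pick] recovers the time of a window, unique by
   [time_interval_inj]; [s0] only fills the times outside [F]. *)
pose theta (F : {set 'I_n}) : {ffun marginal (fun _ => S) F -> R} :=
  [ffun y => if [pick t : 'I_(n - k) | time_interval n t k.+1 == F] is Some t
             then c t (extend_marginal s0 y) else 0].
have prod_theta i : facet_prod (window_complex n k (n - k)) theta i =
    markov_map R S hkn x i.
  rewrite facet_prod_window_complex -[RHS]ger0_norm // ffunE normrM normr_prod.
  transitivity (\prod_t c t i).
    apply: eq_bigr => t _; rewrite ffunE; case: pickP => [s|/(_ t)]; last first.
      by rewrite eqxx.
    move=> /eqP/time_interval_inj ->.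
    have ext := @extend_restrict S s0 n (time_interval n t k.+1) i.
    rewrite /c (eq_window ext); case: eqP => // t0.
    by rewrite t0 in ext *; rewrite (eq_initial _ ext).
  rewrite big_split /=; congr (_ * _).
  have nk0 : (0 < n - k)%N by rewrite subn_gt0.
  rewrite (bigD1 (Ordinal nk0)) //= big1 ?mulr1 // => t.
  by rewrite -val_eqE /= => /negbTE ->.
exists theta; split=> [F _ y|/= i].
  rewrite ffunE; case: pickP => // t _; rewrite /c mulr_ge0 //.
  by case: ifP.
(* The normalizing constant is the total mass, namely 1. *)
by rewrite (eq_bigr _ (fun j _ => prod_theta j)) p1 invr1 mul1r prod_theta.
Qed.

Lemma hierarchical_markov_map (R : realType) (S : finType) n k
    (hkn : (k < n)%N) (p : {ffun path_space S n -> R}) :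
  hierarchical_model R (fun _ : 'I_n => S) (window_complex n k (n - k)) p ->
  range (markov_map R S hkn) p.
Proof.
move=> [_ [theta [_ /= pE]]].
(* The constant initial factor carries the normalization. *)
exists ([ffun=> (\sum_j facet_prod (window_complex n k (n - k)) theta j)^-1],
        [ffun t : 'I_(n - k) => [ffun y => theta (time_interval n t k.+1)
           (restrict (time_interval n t k.+1) (extend_window n t y))]]) => //.
apply/ffunP => i; rewrite pE !ffunE; congr (_ * _).
rewrite facet_prod_window_complex; apply: eq_bigr => t _; rewrite !ffunE.
by congr (theta _ _); apply/eq_restrict/extend_window_window.
Qed.

Theorem lemma4p3 (R : realType) (S : finType) (k n : nat)
    (hS : (0 < #|S|)%N) (hk : (1 <= k)%N) (hkn : (k < n)%N) :
  exists Gamma : {set {set 'I_n}},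
    [/\ simplicial_complex Gamma,
        decomposable Gamma \/ (n = k.+1 /\ is_simplex Gamma) &
        (range (markov_map R S hkn) `&` prob_simplex R (path_space S n))%classic
        = hierarchical_model R (fun _ : 'I_n => S) Gamma].
Proof.
exists (window_complex n k (n - k)); split.
- exact: simplicial_window_complex.
(* A single window ([n = k.+1]) gives the full simplex; from two windows on, splitting off the last
   one is a genuine reduction. *)
- case: (n - k)%N (subnKC (ltnW hkn)) => [|[|r]] nE.
  + by lia.
  + right; split; first by lia.
    by exists (time_interval n 0 k.+1); apply: window_complex1.
  + left; apply: (Decomposable (window_complex_reducible _)).
    * by lia.
    * by apply: window_complex_decomposable; lia.
    * by right; exists (time_interval n r.+1 k.+1).
- have [s0 _] := card_gt0P hS; apply/seteqP; split=> [p [[x _ <-]]|p hp].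
    exact: markov_map_hierarchical.
  by split; [apply: hierarchical_markov_map | case: hp].
Qed.
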